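(* Let $Q=2^m$ and let $a,b,c\in\mathbb F_Q$ with $a+b+c\in T_0$ and $c\ne0$. Let $e\in\mathbb F_2$, $\epsilon=(-1)^e$, and $v\in\mathbb F_Q$ with $\mathrm{Tr}(v)=e$. Let $\ell,m$ be distinct non-tangent lines with $\ell\in\mathcal L_\epsilon$ and $\hat\rho(\ell,m)=c$, and let $\pi^c_{a,b}(\epsilon)$ be the number of non-tangent lines $n$ (including possibly $\ell$ or $m$) with $\hat\rho(\ell,n)=a$ and $\hat\rho(n,m)=b$. Then $$\pi^c_{a,b}(\epsilon)=\sum_\tau\bigl|\{z\in\mathbb F_Q\cup\{\infty\}:z^2+z=v+ac/\tau^2\}\bigr|=\begin{cases}1+2|T_e\cap\{ac\}|,&\text{if }a+b+c=0,\\ 2\sum_\tau|T_e\cap\{ac/\tau^2\}|,&\text{if }a+b+c\in T_0^*.\end{cases}$$ Here both sums run over the two elements $\tau\in\mathbb F_Q$ with $\tau^2+\tau=a+b+c$. By convention, for $\tau=0$ the equation $z^2+z=v+ac/\tau^2$ has $z=\infty$ as its only solution.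
   Context: Let $Q=2^m$ and work in $\mathrm{PG}(2,Q)$. Conic and lines. - Points are nonzero vectors up to scalars, and $(a,b,c)^\perp$ denotes the line $aX+bY+cZ=0$. - The conic is $\mathcal O=\{(\xi,\xi^2,1)^\top:\xi\in\mathbb F_Q\}\cup\{(0,1,0)^\top\}$. - The non-tangent lines (meeting $\mathcal O$ in $0$ or $2$ points) are exactly the lines $(1,x,y)^\perp$, $x,y\in\mathbb F_Q$. - Such a line lies in $\mathcal L_1$ (secant) if $\mathrm{Tr}(xy)=0$ and in $\mathcal L_{-1}$ (exterior) if $\mathrm{Tr}(xy)=1$, where $\mathrm{Tr}$ is the absolute trace $\mathbb F_Q\to\mathbb F_2$. Modified cross-ratio. - For $\ell=(1,x,y)^\perp$ and $n=(1,z,u)^\perp$: $\hat\rho(\ell,n)=x^2u^2+y^2z^2+(x+z)(y+u)$. Other notation. - $T_e=\{x\in\mathbb F_Q:\mathrm{Tr}(x)=e\}$ and $T_0^*=T_0\setminus\{0\}$. *)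

(* Defs.v *)
From HB Require Import structures.
From mathcomp Require Import all_boot all_order all_algebra.
Set Implicit Arguments.
Unset Strict Implicit.
Unset Printing Implicit Defensive.
Import GRing.Theory.
Local Open Scope ring_scope.

(* For #|F| = 2 ^ m this is x + x^2 + x^4 + ... + x^(2^(m-1)); the prime field
   F_2 is identified with {0, 1} inside F. *)
Definition Tr (F : finFieldType) (x : F) : F :=
  \sum_(i < logn 2 #|F|) x ^+ (2 ^ i).

Definition T (F : finFieldType) (e : 'F_2) : {set F} :=
  [set x : F | Tr x == (e : nat)%:R].

Definition T0star (F : finFieldType) : {set F} := T F 0 :\ 0.

Definition row3 (F : finFieldType) (a b c : F) : 'rV[F]_3 :=
  \row_(j < 3) [:: a; b; c]`_j.

(* A point of PG(2,Q) is the class of a nonzero column vector up to nonzero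
   scalars, and a line is a set of points. *)
Definition point (F : finFieldType) (u : 'cV[F]_3) : {set 'cV[F]_3} :=
  [set k *: u | k : F & k != 0].

Definition perp (F : finFieldType) (w : 'rV[F]_3) : {set {set 'cV[F]_3}} :=
  [set point u | u : 'cV[F]_3 & (u != 0) && (w *m u == 0)].

Definition lines (F : finFieldType) : {set {set {set 'cV[F]_3}}} :=
  [set perp w | w : 'rV[F]_3 & w != 0].

Definition conic (F : finFieldType) : {set {set 'cV[F]_3}} :=
  [set point (row3 xi (xi ^+ 2) 1)^T | xi : F] :|: [set point (row3 0 1 0)^T].

Definition nontangent (F : finFieldType) : {set {set {set 'cV[F]_3}}} :=
  [set l in lines F | (#|l :&: conic F| == 0)%N || (#|l :&: conic F| == 2)%N].

(* The pair (x, y) with l = (1,x,y)^perp; it is unique by coordK below, and it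
   exists when l is non-tangent and F has characteristic 2. The default (0, 0)
   is used only for lines not of this form. *)
Definition coord (F : finFieldType) (l : {set {set 'cV[F]_3}}) : F * F :=
  odflt (0, 0) [pick xy : F * F | l == perp (row3 1 xy.1 xy.2)].

(* The classes L_1 (secant lines) and L_{-1} (exterior lines). *)
Definition L (F : finFieldType) (eps : int) : {set {set {set 'cV[F]_3}}} :=
  [set l in nontangent F |
     let: (x, y) := coord l in
     ((eps == 1) && (Tr (x * y) == 0)) || ((eps == -1) && (Tr (x * y) == 1))].


Definition rhohat (F : finFieldType) (l n : {set {set 'cV[F]_3}}) : F :=
  let: (x, y) := coord l in
  let: (z, u) := coord n in
  x ^+ 2 * u ^+ 2 + y ^+ 2 * z ^+ 2 + (x + z) * (y + u).

Definition pi_count (F : finFieldType) (a b : F)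
    (l m : {set {set 'cV[F]_3}}) : nat :=
  #|[set n in nontangent F | (rhohat l n == a) && (rhohat n m == b)]|.

(* Solutions z of z^2 + z = v + a c / tau^2 in the union of F and {infinity},
   with None for infinity. For tau != 0 the right-hand side is finite, so
   infinity is not a solution. *)
Definition sols (F : finFieldType) (v a c tau : F) : {set option F} :=
  [set z : option F |
     if tau == 0 then z == None
     else if z is Some w then w ^+ 2 + w == v + a * c / tau ^+ 2 else false].

Lemma row3_mul (F : finFieldType) (a b c x y z : F) :
  row3 a b c *m (row3 x y z)^T = (a * x + b * y + c * z)%:M.
Proof.
apply/matrixP => i j; rewrite !ord1 !mxE !big_ord_recr big_ord0 /= !mxE /=.
by rewrite add0r mulr1n.
Qed.

Lemma perp_point (F : finFieldType) (a b c x y z : F) : row3 x y z != 0 ->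
  (point (row3 x y z)^T \in perp (row3 a b c)) = (a * x + b * y + c * z == 0).
Proof.
move=> nz; have -> : (a * x + b * y + c * z == 0)
    = (row3 a b c *m (row3 x y z)^T == 0).
  rewrite row3_mul; apply/eqP/eqP => [-> | /matrixP/(_ 0 0)].
    by apply/matrixP => i j; rewrite !mxE mul0rn.
  by rewrite !mxE mulr1n.
apply/imsetP/idP => [[u] | wu0]; last first.
  exists (row3 x y z)^T => //; rewrite inE wu0 andbT.
  by apply: contra nz => /eqP h; rewrite -[row3 _ _ _]trmxK h trmx0.
rewrite inE => /andP[_ /eqP wu0] /setP/(_ (row3 x y z)^T).
have -> : (row3 x y z)^T \in point (row3 x y z)^T.
  by apply/imsetP; exists 1; rewrite ?inE ?oner_eq0 ?scale1r.
move/esym/imsetP => [k _ ->].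
by rewrite -scalemxAr wu0 scaler0.
Qed.

Lemma coordK (F : finFieldType) (x y : F) : coord (perp (row3 1 x y)) = (x, y).
Proof.
rewrite /coord; case: pickP => [[x' y'] /= /eqP h | /(_ (x, y))]; last by rewrite eqxx.
have nz1 : row3 (- x) 1 0 != 0.
  by apply/eqP => /matrixP/(_ 0 1); rewrite !mxE /= => /eqP; rewrite oner_eq0.
have nz2 : row3 (- y) 0 1 != 0.
  by apply/eqP => /matrixP/(_ 0 ord_max); rewrite !mxE /= => /eqP; rewrite oner_eq0.
have := perp_point 1 x y nz1; have := perp_point 1 x y nz2.
rewrite h !perp_point // !mul1r !mulr1 !mulr0 !addr0 !addNr eqxx.
by rewrite ![- _ + _]addrC !subr_eq0 => /eqP-> /eqP->.
Qed.

(* Main.v *)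
Require Import Defs.
From HB Require Import structures.
From mathcomp Require Import all_boot all_order all_algebra.
From mathcomp Require Import finfield ring.
Set Implicit Arguments.
Unset Strict Implicit.
Unset Printing Implicit Defensive.
Import GRing.Theory.
Local Open Scope ring_scope.

(* Put l = (1,x,y)^perp, n = l + (s,t) and m = l + (al,be) in coordinates. Then
   rhohat(l,n) is the quadratic form q(s,t) = y^2 s^2 + s t + x^2 t^2, and
   rhohat(n,m) = q(s,t) + q(al,be) + tau + tau^2, where tau = be s + al t is the
   polar form of (s,t) and (al,be). As q(al,be) = c, the lines n to be counted are
   the points with q(s,t) = a on the lines be s + al t = tau, tau^2 + tau = a+b+c.
   For tau = 0 there is one such point, as squaring is bijective. For tau <> 0 a
   rescaling turns the equation into w^2 + w = v + a c / tau^2 for some v of trace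
   Tr(xy), and changing v within its trace class only translates w, by Hilbert's
   Theorem 90 in its additive form. *)

(** * Arithmetic in characteristic 2 *)

(* Reduces an identity in characteristic 2 to one that [ring] can check over
   the integers, at the price of the witness [w]. *)
Lemma eq_pchar2 (R : comNzRingType) (w x y : R) :
  2 \in [pchar R] -> x = y + 2 * w -> x = y.
Proof. by move=> char2 ->; rewrite (pcharf0 char2) mul0r addr0. Qed.

Lemma addr_eq0_pchar2 (R : comNzRingType) (x y : R) :
  2 \in [pchar R] -> (x + y == 0) = (x == y).
Proof. by move=> char2; rewrite addr_eq0 oppr_pchar2. Qed.

Lemma sqrrD_pchar2 (R : comNzRingType) (x y : R) :
  2 \in [pchar R] -> (x + y) ^+ 2 = x ^+ 2 + y ^+ 2.
Proof. by move=> char2; rewrite sqrrD mulrn_pchar ?addr0. Qed.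

Lemma sqr_inj_pchar2 (F : fieldType) :
  2 \in [pchar F] -> injective (fun x : F => x ^+ 2).
Proof.
move=> char2 x y /eqP.
by rewrite -addr_eq0_pchar2 // -sqrrD_pchar2 // sqrf_eq0 addr_eq0_pchar2 //
  => /eqP.
Qed.

(** Squaring is injective in characteristic 2, hence bijective on a finite field. *)
Lemma sqrt_exists_pchar2 (F : finFieldType) (d : F) :
  2 \in [pchar F] -> exists x : F, x ^+ 2 = d.
Proof.
move=> char2; have [g _ gK] := injF_bij (@sqr_inj_pchar2 F char2).
by exists (g d); apply: gK.
Qed.

(** * The map [x^2 + x], the trace and the additive Hilbert 90 *)

Lemma artin_schreierD (F : fieldType) (x y : F) : 2 \in [pchar F] ->
  (x + y) ^+ 2 + (x + y) = (x ^+ 2 + x) + (y ^+ 2 + y).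
Proof. by move=> char2; rewrite sqrrD_pchar2 // addrACA. Qed.

(** The map [x^2 + x] is additive with kernel [{0, 1}], so each nonempty fibre is a translate of
    this kernel. *)
Lemma artin_schreier_roots (F : finFieldType) (w d : F) : 2 \in [pchar F] ->
  w ^+ 2 + w = d -> [set x : F | x ^+ 2 + x == d] = [set w; w + 1].
Proof.
move=> char2 <-; apply/setP => x; rewrite !inE.
rewrite -addr_eq0_pchar2 // -artin_schreierD // expr2 -{3}[x + w]mulr1 -mulrDr.
rewrite mulf_eq0 addr_eq0_pchar2 //; congr (_ || _).
by rewrite -addrA addr_eq0_pchar2.
Qed.

Lemma card_artin_schreier_roots (F : finFieldType) (w : F) : 2 \in [pchar F] ->
  #|[set x : F | x ^+ 2 + x == w ^+ 2 + w]| = 2.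
Proof.
move=> char2; rewrite (@artin_schreier_roots _ w) // cards2.
by rewrite -{1}[w]addr0 (inj_eq (addrI w)) eq_sym oner_eq0.
Qed.

Lemma TrD (F : finFieldType) (x y : F) : 2 \in [pchar F] ->
  Tr (x + y) = Tr x + Tr y.
Proof.
move=> char2; rewrite /Tr -big_split; apply: eq_bigr => i _ /=.
by rewrite exprDn_pchar // (eq_pnat _ (pcharf_eq char2)) pnatX pnat_id.
Qed.

(** Since signs do not matter, the trace of [x^2 + x] telescopes to [x^Q - x], with [Q] the order of
    the field, and this vanishes. *)
Lemma Tr_artin_schreier (F : finFieldType) (x : F) :
  2 \in [pchar F] -> #|F| = (2 ^ logn 2 #|F|)%N -> Tr (x ^+ 2 + x) = 0.
Proof.
move=> char2 hQ; rewrite TrD // /Tr -big_split /=.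
rewrite -(big_mkord xpredT (fun i => (x ^+ 2) ^+ (2 ^ i) + x ^+ (2 ^ i))).
transitivity (\sum_(0 <= i < logn 2 #|F|) (x ^+ (2 ^ i.+1) - x ^+ (2 ^ i))).
  by apply: eq_bigr => i _; rewrite -exprM -expnS oppr_pchar2.
rewrite (telescope_sumr (fun i => x ^+ (2 ^ i))) // -hQ expf_card.
by rewrite expn0 expr1 subrr.
Qed.

(** The trace is a polynomial function of degree at most half the field order. The polynomial is
    nonzero because its coefficient at [X] is 1, so its degree bounds the number of roots. *)
Lemma card_Tr_ker (F : finFieldType) : (0 < logn 2 #|F|)%N ->
  (#|[set x : F | (Tr x == 0)%R]| <= 2 ^ (logn 2 #|F|).-1)%N.
Proof.
move=> k0; pose P : {poly F} := \sum_(i < logn 2 #|F|) 'X^(2 ^ i).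
have Px x : P.[x] = Tr x.
  by rewrite horner_sum; apply: eq_bigr => i _; rewrite hornerXn.
have P0 : P != 0.
  apply/eqP => /(congr1 (coefp 1)) /eqP; rewrite /= coef_sum coef0.
  rewrite (bigD1 (Ordinal k0)) //= coefXn eqxx big1 ?addr0 ?oner_eq0 // => i.
  rewrite -val_eqE /= => i0.
  by rewrite coefXn -[X in (X == _)%N](expn0 2) eqn_exp2l // eq_sym (negPf i0).
have sP : (size P <= (2 ^ (logn 2 #|F|).-1).+1)%N.
  apply: leq_trans (size_sum _ _ _) _; apply/bigmax_leqP => i _.
  by rewrite size_polyXn ltnS leq_pexp2l // -ltnS prednK.
rewrite cardE -ltnS; apply: leq_trans sP; apply: max_poly_roots => //.
  by apply/allP => x; rewrite mem_enum inE -Px.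
exact: enum_uniq.
Qed.

(** Additive Hilbert 90 by counting: the fibres of [x^2 + x] over its image have two elements, so
    the image has [Q/2] elements. It lies in the trace kernel, which has at most [Q/2], so the two
    coincide. *)
Lemma Tr_eq0P (F : finFieldType) (d : F) :
  2 \in [pchar F] -> #|F| = (2 ^ logn 2 #|F|)%N ->
  reflect (exists w, w ^+ 2 + w = d) (Tr d == 0).
Proof.
move=> char2 hQ; have k0 : (0 < logn 2 #|F|)%N.
  by rewrite lt0n; apply: contraTneq (finNzRing_gt1 F) => k0; rewrite hQ k0.
pose AS (x : F) := x ^+ 2 + x.
have sub : AS @: setT \subset [set x : F | Tr x == 0].
  by apply/subsetP => _ /imsetP[x _ ->]; rewrite inE Tr_artin_schreier.
have cardAS : #|F| = (#|AS @: setT| * 2)%N.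
  rewrite -cardsT -sum1_card (partition_big_imset AS) /= -sum_nat_const.
  apply: eq_bigr => _ /imsetP[w _ ->].
  by rewrite -[RHS](card_artin_schreier_roots w) // -sum1dep_card;
    apply: eq_bigl => x; rewrite inE.
have /eqP E : AS @: setT == [set x : F | Tr x == 0].
  rewrite eqEcard sub; apply: leq_trans (card_Tr_ker k0) _.
  have {}hQ : #|F| = (2 ^ (logn 2 #|F|).-1 * 2)%N by rewrite -expnSr prednK.
  by rewrite -(@leq_pmul2r 2) // -cardAS -hQ.
have -> : (Tr d == 0) = (d \in AS @: setT) by rewrite E inE.
apply: (iffP imsetP) => [[w _ ->] | [w <-]]; first by exists w.
by exists w.
Qed.

Lemma card_artin_schreier (F : finFieldType) (d : F) :
  2 \in [pchar F] -> #|F| = (2 ^ logn 2 #|F|)%N ->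
  #|[set x : F | x ^+ 2 + x == d]| = if Tr d == 0 then 2 else 0.
Proof.
move=> char2 hQ; case: (Tr_eq0P d char2 hQ) => [[w <-] | no].
  exact: card_artin_schreier_roots.
apply/eqP; rewrite cards_eq0; apply/eqP/setP => x; rewrite !inE.
by apply/eqP => h; apply: no; exists x.
Qed.

(** * Counting the solutions for one value of [tau] *)

Lemma card_sols0 (F : finFieldType) (v a c : F) : #|sols v a c 0| = 1%N.
Proof.
rewrite -[RHS](cards1 (None : option F)); apply: eq_card => z.
by rewrite !inE eqxx.
Qed.

Lemma card_solsN0 (F : finFieldType) (v a c tau : F) : tau != 0 ->
  #|sols v a c tau| = #|[set w : F | w ^+ 2 + w == v + a * c / tau ^+ 2]|.
Proof.
move=> /negPf t0; have someI : injective (@Some F) by move=> ? ? [].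
rewrite -(card_imset _ someI); apply: eq_card => z.
rewrite inE t0; case: z => [w|]; last by apply/esym/imsetP => -[].
by rewrite mem_imset ?inE.
Qed.

(** The equation has two roots or none, and it has roots exactly when [a c / tau^2] has the same
    trace as [v], namely [e]. *)
Lemma card_sols_trace (F : finFieldType) (e : 'F_2) (v a c tau : F) :
  2 \in [pchar F] -> #|F| = (2 ^ logn 2 #|F|)%N -> Tr v = (e : nat)%:R ->
  tau != 0 ->
  #|sols v a c tau| = (2 * #|T F e :&: [set (a * c / tau ^+ 2)%R]|)%N.
Proof.
move=> char2 hQ hv t0; rewrite card_solsN0 // card_artin_schreier // TrD //.
rewrite addr_eq0_pchar2 // hv setIC; case: eqP => h.
  suff -> : [set a * c / tau ^+ 2] :&: T F e = [set a * c / tau ^+ 2].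
    by rewrite cards1.
  by apply/setIidPl; rewrite sub1set inE -h.
suff -> : [set a * c / tau ^+ 2] :&: T F e = set0 by rewrite cards0.
apply/setP => z; rewrite !inE; case: eqP => //= ->.
by apply/eqP => h'; apply: h.
Qed.

(** * Points of a conic on a line *)

(* Substituting [t = (tau + be s) / al] turns the form into
   [c s^2 + al tau s + x^2 tau^2] up to the factor [al^2]. *)
Lemma card_conic_line_aux (F : finFieldType) (v x y al be c a tau : F) :
  2 \in [pchar F] -> #|F| = (2 ^ logn 2 #|F|)%N -> Tr v = Tr (x * y) ->
  al != 0 -> c != 0 ->
  y ^+ 2 * al ^+ 2 + al * be + x ^+ 2 * be ^+ 2 = c ->
  #|[set p : F * F | (be * p.1 + al * p.2 == tau) &&
       (y ^+ 2 * p.1 ^+ 2 + p.1 * p.2 + x ^+ 2 * p.2 ^+ 2 == a)]|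
  = #|sols v a c tau|.
Proof.
move=> char2 hQ hv al0 c0 hc.
pose q s t := y ^+ 2 * s ^+ 2 + s * t + x ^+ 2 * t ^+ 2.
have lineE s t : (be * s + al * t == tau) = (t == (tau + be * s) / al).
  rewrite addrC -(inj_eq (addIr (be * s))) -addrA addrr_pchar2 // addr0 mulrC.
  by rewrite -(inj_eq (mulIf al0) t) divfK.
have qE s : al ^+ 2 * q s ((tau + be * s) / al)
    = c * s ^+ 2 + al * tau * s + x ^+ 2 * tau ^+ 2.
  apply: (eq_pchar2 (w := x ^+ 2 * tau * be * s)) => //.
  by rewrite /q -hc; field.
have [tau0|tau0] := eqVneq tau 0.
  rewrite tau0 card_sols0 -tau0.
  (* For [tau = 0] the linear and constant terms of [qE] vanish, leaving [c s^2 = al^2 a], which has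
     a unique root [s0]. *)
  have [s0 hs0] := sqrt_exists_pchar2 (a * al ^+ 2 / c) char2.
  rewrite -[RHS](cards1 (s0, (tau + be * s0) / al)); apply: eq_card => -[s t].
  rewrite !inE /= lineE xpair_eqE.
  have [->|nt] := eqVneq t ((tau + be * s) / al); last first.
    by apply/esym/negbTE; apply: contra nt => /andP[/eqP -> /eqP ->].
  rewrite -/(q _ _) -(inj_eq (mulfI (expf_neq0 2 al0))) qE tau0.
  rewrite /= mulr0 mul0r expr0n /= mulr0 !addr0.
  have -> : al ^+ 2 * a = c * s0 ^+ 2 by rewrite hs0; field.
  rewrite (inj_eq (mulfI c0)) (inj_eq (sqr_inj_pchar2 char2)).
  by case: eqVneq => //= ->; rewrite eqxx.
(* The element [x y + x^2 c / al^2] is the image of [x y + x^2 be / al] under [z^2 + z], so [v] and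
   [x^2 c / al^2] have equal traces. The shift [h] will trade one constant term for the other. *)
have [h hh] : exists h, h ^+ 2 + h = v + x ^+ 2 * c / al ^+ 2.
  apply/Tr_eq0P => //; rewrite TrD // hv -TrD //.
  apply/Tr_eq0P => //; exists (x * y + x ^+ 2 * be / al).
  apply: (eq_pchar2 (w := x ^+ 3 * y * be / al)) => //.
  by rewrite -hc; field.
rewrite card_solsN0 //.
(* The scaling by [al tau / c] makes the quadratic and linear coefficients of [qE] equal, and the
   shift by [h] turns the constant term into [v]. Thus [f] parametrizes the line by [w]. *)
pose f w := let s := al * tau * (w + h) / c in (s, (tau + be * s) / al).
have f_inj : injective f.
  move=> w1 w2 [] /(mulIf (invr_neq0 c0)) /(mulfI (mulf_neq0 al0 tau0)) E _.
  exact: (addIr h).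
have qf w : q (f w).1 (f w).2 = tau ^+ 2 / c * (w ^+ 2 + w + v).
  apply: (mulfI (expf_neq0 2 al0)); rewrite qE.
  transitivity (al ^+ 2 * tau ^+ 2 / c * ((w + h) ^+ 2 + (w + h))
      + x ^+ 2 * tau ^+ 2).
    by rewrite /f /=; field.
  rewrite artin_schreierD // hh.
  by apply: (eq_pchar2 (w := x ^+ 2 * tau ^+ 2)) => //; field; rewrite al0 c0.
have qfE w : (q (f w).1 (f w).2 == a) = (w ^+ 2 + w == v + a * c / tau ^+ 2).
  rewrite qf -(addr_eq0_pchar2 (w ^+ 2 + w)) // addrA addr_eq0_pchar2 //.
  have k0 : tau ^+ 2 / c != 0 by rewrite mulf_neq0 ?invr_eq0 ?expf_neq0.
  rewrite -[RHS](inj_eq (mulfI k0)); congr (_ == _); field.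
  by rewrite tau0 c0.
rewrite -(card_imset _ f_inj); apply: eq_card => -[s t]; rewrite !inE /=.
rewrite lineE; apply/andP/imsetP => [[/eqP -> qa] | [w]].
  have E : f (s * c / (al * tau) + h) = (s, (tau + be * s) / al).
    rewrite /f -addrA addrr_pchar2 // addr0.
    have -> : al * tau * (s * c / (al * tau)) / c = s.
      by field; rewrite al0 tau0 c0.
    by [].
  exists (s * c / (al * tau) + h) => //; rewrite inE -qfE E; exact: qa.
by rewrite inE -qfE => qa E; split; move: qa; rewrite -E //; case: E => -> ->.
Qed.

(** If [al = 0], then [be] is nonzero because [c] is, and exchanging the two coordinates, together
    with [x] and [y], reduces to the case already settled. *)
Lemma card_conic_line (F : finFieldType) (v x y al be c a tau : F) :
  2 \in [pchar F] -> #|F| = (2 ^ logn 2 #|F|)%N -> Tr v = Tr (x * y) ->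
  c != 0 -> y ^+ 2 * al ^+ 2 + al * be + x ^+ 2 * be ^+ 2 = c ->
  #|[set p : F * F | (be * p.1 + al * p.2 == tau) &&
       (y ^+ 2 * p.1 ^+ 2 + p.1 * p.2 + x ^+ 2 * p.2 ^+ 2 == a)]|
  = #|sols v a c tau|.
Proof.
move=> char2 hQ hv c0 hc.
have [al0|] := eqVneq al 0; last by move=> al0; apply: card_conic_line_aux.
have be0 : be != 0.
  by apply: contraNneq c0 => be0; rewrite -hc al0 be0 !(expr0n, mulr0, addr0).
have swap_inj : injective (fun p : F * F => (p.2, p.1)).
  by case=> ? ? [? ?] [-> ->].
rewrite -(card_imset _ swap_inj).
rewrite -(@card_conic_line_aux F v y x be al c a tau) ?(mulrC y x) //; last first.
  by rewrite -hc; ring.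
apply: eq_card => -[s t]; apply/imsetP/idP => [[[s' t']] |].
  rewrite !inE /= => /andP[h1 h2] [-> ->].
  rewrite addrC h1 -(eqP h2) /=; apply/eqP; ring.
rewrite !inE /= => /andP[h1 h2]; exists (t, s) => //.
rewrite !inE /= addrC h1 -(eqP h2) /=; apply/eqP; ring.
Qed.

(** * The count in coordinates *)

Definition rhohat_coord (F : finFieldType) (p q : F * F) : F :=
  p.1 ^+ 2 * q.2 ^+ 2 + p.2 ^+ 2 * q.1 ^+ 2 + (p.1 + q.1) * (p.2 + q.2).

Lemma card_rhohat_coord (F : finFieldType) (v a b c : F) (l m : F * F) :
  2 \in [pchar F] -> #|F| = (2 ^ logn 2 #|F|)%N -> Tr v = Tr (l.1 * l.2) ->
  c != 0 -> rhohat_coord l m = c ->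
  #|[set n : F * F | (rhohat_coord l n == a) && (rhohat_coord n m == b)]|
  = (\sum_(tau : F | (tau ^+ 2 + tau == a + b + c)%R) #|sols v a c tau|)%N.
Proof.
case: l m => [x y] [z u] char2 hQ hv c0 hc.
set al := x + z; set be := y + u.
pose q s t := y ^+ 2 * s ^+ 2 + s * t + x ^+ 2 * t ^+ 2.
have qc : q al be = c.
  rewrite -hc /q /al /be /rhohat_coord /=.
  by apply: (eq_pchar2 (w := x ^+ 2 * y ^+ 2 + x * z * y ^+ 2
    + x ^+ 2 * y * u)) => //; ring.
have q1 s t : rhohat_coord (x, y) (x + s, y + t) = q s t.
  rewrite /rhohat_coord /q /=.
  by apply: (eq_pchar2 (w := x ^+ 2 * y ^+ 2 + x ^+ 2 * y * t + x * y ^+ 2 * s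
      + x * (2 * y + t) + s * y)) => //; ring.
have q2 s t : rhohat_coord (x + s, y + t) (z, u)
    = q s t + c + ((be * s + al * t) ^+ 2 + (be * s + al * t)).
  rewrite -qc /rhohat_coord /q /al /be /=.
  apply: (eq_pchar2 (w := x * u ^+ 2 * s + y * z ^+ 2 * t - y ^+ 2 * s ^+ 2
    - x ^+ 2 * t ^+ 2 - x ^+ 2 * y ^+ 2 - x * y ^+ 2 * z - x ^+ 2 * y * u
    - y * u * s ^+ 2 - x * y * s * t - y * z * s * t - x * u * s * t
    - z * u * s * t - x * z * t ^+ 2)) => //; ring.
(* Translation moves [l] to the origin. On [q = a] the second condition then only involves the polar
   form. *)
pose shift (p : F * F) := (x + p.1, y + p.2).
have shift_inj : injective shift.
  by move=> [s1 t1] [s2 t2] [] /addrI -> /addrI ->.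
transitivity #|[set p : F * F | (q p.1 p.2 == a) &&
   ((be * p.1 + al * p.2) ^+ 2 + (be * p.1 + al * p.2) == a + b + c)]|.
  rewrite -[RHS](card_imset _ shift_inj); apply: eq_card => -[n1 n2].
  have -> : (n1, n2) = shift (n1 - x, n2 - y).
    by rewrite /shift /= ![_ + (_ - _)]addrC !subrK.
  rewrite mem_imset // !inE q1 q2 /=; case: eqP => //= ->.
  rewrite -addr_eq0_pchar2 // -[RHS]addr_eq0_pchar2 //; congr (_ == 0); ring.
rewrite -sum1dep_card.
(* The points are sorted by the value [tau] of the polar form, which leaves a conic and a line for
   each [tau]. *)
rewrite (partition_big (fun p => be * p.1 + al * p.2)
  (fun tau => tau ^+ 2 + tau == a + b + c)) /=; last by move=> p /andP[].
apply: eq_bigr => tau htau.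
rewrite -(@card_conic_line F v x y al be c a tau) // -sum1dep_card.
apply: eq_bigl => p; rewrite -/(q _ _).
by case: (eqVneq (be * p.1 + al * p.2)) => [->|_]; rewrite ?andbF //= htau !andbT.
Qed.

(** * Non-tangent lines and their coordinates *)

Lemma perpZ (F : finFieldType) (k : F) (w : 'rV[F]_3) :
  k != 0 -> perp (k *: w) = perp w.
Proof.
move=> k0; apply/setP => P; apply/imsetP/imsetP => -[u] h ->;
  by exists u => //; move: h; rewrite !inE -scalemxAl scaler_eq0 (negPf k0).
Qed.

Lemma row3_neq0 (F : finFieldType) (a b c : F) :
  (row3 a b c != 0) = [|| a != 0, b != 0 | c != 0].
Proof.
rewrite -!negb_and; congr (~~ _); apply/eqP/and3P
  => [/matrixP h | [/eqP-> /eqP-> /eqP->]].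
  split; apply/eqP; [move: (h 0 0) | move: (h 0 1) | move: (h 0 ord_max)];
    by rewrite !mxE.
by apply/matrixP => i j; rewrite !mxE; case: j => [[|[|[|]]]].
Qed.

Lemma row3_eta (F : finFieldType) (w : 'rV[F]_3) :
  w = row3 (w 0 0) (w 0 1) (w 0 ord_max).
Proof.
apply/matrixP => i j; rewrite ord1 !mxE.
by case: j => [[|[|[|]]]] //= lt3; congr (w 0 _); apply: val_inj.
Qed.

(** The roots [xi] give the affine points of the conic on the line, and the term for [b = 0]
    accounts for the point [(0,1,0)]. *)
Lemma card_perp_conic (F : finFieldType) (a b c : F) :
  #|perp (row3 a b c) :&: conic F|
  = (#|[set xi : F | (a * xi + b * xi ^+ 2 + c == 0)%R]| + (b == 0)%R)%N.
Proof.
pose pt (xi : F) := point (row3 xi (xi ^+ 2) 1)^T.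
have nz (xi : F) : row3 xi (xi ^+ 2) 1 != 0 by rewrite row3_neq0 oner_eq0 !orbT.
have nzo : row3 0 1 0 != 0 :> 'rV[F]_3 by rewrite row3_neq0 oner_eq0 !orbT.
have pt_inj : injective pt.
  (* The line [(1,0,-xj)^perp] passes through [pt xj], and through [pt xi] only if [xi = xj]. *)
  move=> xi xj E; have := perp_point 1 0 (- xj) (nz xi).
  rewrite -/(pt _) E perp_point // !mul1r !mul0r !mulr1 !addr0 subrr eqxx.
  by move/esym; rewrite subr_eq0 => /eqP.
rewrite /conic setIUr cardsU.
have -> : perp (row3 a b c) :&: [set pt xi | xi : F]
    = pt @: [set xi : F | a * xi + b * xi ^+ 2 + c == 0].
  apply/setP => P; apply/setIP/imsetP => [[h /imsetP[xi _ E]] | [xi]].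
    by exists xi => //; move: h; rewrite E perp_point // mulr1 inE.
  by rewrite inE => h ->; split; [rewrite perp_point // mulr1 | apply: imset_f].
rewrite card_imset //.
have -> : #|perp (row3 a b c) :&: [set point (row3 0 1 0)^T]| = (b == 0)%R.
  have := perp_point a b c nzo; rewrite !mulr0 add0r addr0 mulr1 => E.
  case: eqP E => _ E; first by rewrite (setIidPr _) ?cards1 // sub1set.
  apply/eqP; rewrite cards_eq0 setI_eq0 disjoint_sym disjoints1 ?E //.
rewrite [X in (_ - X)%N](_ : _ = 0%N) ?subn0 //.
apply/eqP; rewrite cards_eq0; apply/eqP/setP => P; rewrite !inE.
apply/negP => /andP[/imsetP[xi _ ->] /andP[_ /eqP E]].
(* The line [(0,0,1)^perp] contains [(0,1,0)] but no affine point, so the two parts of the conic are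
   disjoint. *)
have := perp_point 0 0 1 (nz xi); have := perp_point 0 0 1 nzo.
by rewrite -E => ->; rewrite !mul0r !mul1r !add0r eqxx oner_eq0.
Qed.

(** A line with first coordinate 0 meets the conic exactly once: in [(0,1,0)] if [b = 0], and
    otherwise in the affine point given by the unique square root of [c / b]. Any other line can be
    scaled to first coordinate 1, and then meets the conic in 0 or 2 points. *)
Lemma nontangentE (F : finFieldType) :
  2 \in [pchar F] -> #|F| = (2 ^ logn 2 #|F|)%N ->
  nontangent F = [set perp (row3 1 p.1 p.2) | p : F * F].
Proof.
move=> char2 hQ; apply/setP => l; rewrite inE; apply/andP/imsetP.
  move=> [/imsetP[w]]; rewrite inE (row3_eta w).
  move: (w 0 0) (w 0 1) (w 0 ord_max) => {w} a b c w0 -> h.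
  have [a0|a0] := eqVneq a 0; last first.
    exists (b / a, c / a) => //=; rewrite -[RHS](perpZ _ a0); congr perp.
    apply/matrixP => i j; rewrite !mxE.
    by case: j => [[|[|[|]]]] //= _; rewrite ?mulr1 // mulrCA divff ?mulr1.
  suff E : #|perp (row3 a b c) :&: conic F| = 1 by rewrite E in h.
  rewrite card_perp_conic a0; have [b0|b0] := eqVneq b 0.
    have c0 : c != 0 by move: w0; rewrite row3_neq0 a0 b0 eqxx.
    rewrite (_ : [set _ | _] = set0) ?cards0 //; apply/setP => xi.
    by rewrite !inE b0 !mul0r !add0r (negPf c0).
  have [xi hxi] := sqrt_exists_pchar2 (c / b) char2.
  rewrite (_ : [set _ | _] = [set xi]) ?cards1 //; apply/setP => xj.
  rewrite !inE mul0r add0r addr_eq0_pchar2 //.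
  have -> : c = b * xi ^+ 2 by rewrite hxi mulrCA divff ?mulr1.
  by rewrite (inj_eq (mulfI b0)) (inj_eq (sqr_inj_pchar2 char2)).
move=> [[x y] _ ->] /=; split.
  by apply/imsetP; exists (row3 1 x y); rewrite // inE row3_neq0 oner_eq0.
rewrite card_perp_conic; have [x0|x0] := eqVneq x 0.
  rewrite (_ : [set _ | _] = [set y]) ?cards1 ?orbT //; apply/setP => xi.
  by rewrite !inE x0 mul1r mul0r addr0 addr_eq0_pchar2.
(* Multiplying by [x] and putting [w = x xi] gives [w^2 + w = x y], which has 0 or 2 roots. *)
suff -> : #|[set xi : F | 1 * xi + x * xi ^+ 2 + y == 0]|
    = #|[set w : F | w ^+ 2 + w == x * y]|.
  by rewrite card_artin_schreier //; case: ifP.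
rewrite -(card_imset _ (mulfI x0)); apply: eq_card => w.
have -> : w = x * (w / x) by rewrite mulrCA divff ?mulr1.
rewrite mem_imset ?inE; last exact: mulfI.
rewrite -[RHS]addr_eq0_pchar2 //; set t := w / x.
have -> : (x * t) ^+ 2 + x * t + x * y = x * (1 * t + x * t ^+ 2 + y) by ring.
by rewrite mulf_eq0 (negPf x0).
Qed.

(** * From lines to coordinates, and the final formulas *)

Lemma pi_countE (F : finFieldType) (a b : F) (l m : F * F) :
  2 \in [pchar F] -> #|F| = (2 ^ logn 2 #|F|)%N ->
  pi_count a b (perp (row3 1 l.1 l.2)) (perp (row3 1 m.1 m.2))
  = #|[set n : F * F | (rhohat_coord l n == a) && (rhohat_coord n m == b)]|.
Proof.
move=> char2 hQ.
have perp_inj : injective (fun p : F * F => perp (row3 1 p.1 p.2)).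
  by move=> [x y] [z u] /(congr1 (@Defs.coord F)); rewrite !coordK.
rewrite /pi_count nontangentE // -(card_imset _ perp_inj); apply: eq_card => n.
rewrite inE; apply/andP/imsetP => [[/imsetP[p _ ->] h] | [p h ->]].
  by exists p => //; move: h; rewrite inE /rhohat !coordK.
by split; [apply: imset_f | move: h; rewrite inE /rhohat !coordK].
Qed.

Theorem mainTheorem14 (F : finFieldType) (k : nat) (hQ : #|F| = (2 ^ k)%N)
    (a b c : F) (habc : a + b + c \in T F 0) (hc : c != 0)
    (e : 'F_2) (eps : int) (heps : eps = (-1) ^+ (e : nat))
    (v : F) (hv : Tr v = (e : nat)%:R)
    (l m : {set {set 'cV[F]_3}})
    (hl : l \in nontangent F) (hm : m \in nontangent F) (hlm : l != m)
    (hleps : l \in L F eps) (hrho : rhohat l m = c) :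
  [/\ pi_count a b l m
        = (\sum_(tau : F | (tau ^+ 2 + tau == a + b + c)%R)
             #|sols v a c tau|)%N,
      a + b + c = 0 ->
      pi_count a b l m = (1 + 2 * #|T F e :&: [set (a * c)%R]|)%N
    & a + b + c \in T0star F ->
      pi_count a b l m
        = (2 * \sum_(tau : F | (tau ^+ 2 + tau == a + b + c)%R)
                 #|T F e :&: [set (a * c / tau ^+ 2)%R]|)%N].
Proof.
have char2 : 2 \in [pchar F] := card_finPcharP hQ isT.
have {}hQ : #|F| = (2 ^ logn 2 #|F|)%N by rewrite hQ pfactorK.
have countE : pi_count a b l m
    = (\sum_(tau : F | (tau ^+ 2 + tau == a + b + c)%R) #|sols v a c tau|)%N.
  move: hl hm hleps hrho; rewrite nontangentE //
    => /imsetP[p _ ->] /imsetP[q _ ->].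
  rewrite inE => /andP[_ hp] hpq; rewrite pi_countE //.
  apply: card_rhohat_coord => //; last by rewrite -hpq /rhohat !coordK.
  (* The class of [l] says that the product of its coordinates has trace [e], which is the trace of
     [v]; each value of [e] leaves one of the two alternatives. *)
  move: hp; rewrite hv heps coordK.
  by case: (e : 'I_2) => [[|[|]]] //= _ => [/orP[/eqP->|] | /eqP->].
split=> // [h0 | hT0].
  (* Here [tau] is 0 or 1: the value 0 contributes the single solution at infinity, and 1
     contributes the term with [a c]. *)
  have E : [set tau : F | tau ^+ 2 + tau == a + b + c] = [set 0; 1].
    by rewrite -(add0r (1 : F)); apply: artin_schreier_roots;
      rewrite // h0 expr0n addr0.
  rewrite countE (eq_bigl (fun tau => tau \in [set (0 : F); 1])); last first.
    by move=> tau; rewrite -E inE.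
  rewrite big_setU1 ?inE 1?eq_sym ?oner_eq0 //= big_set1 card_sols0.
  by rewrite (card_sols_trace _ _ char2 hQ hv) ?oner_eq0 // expr1n divr1.
rewrite countE big_distrr /=; apply: eq_bigr => tau /eqP htau.
(* The value [tau = 0] would force [a + b + c = 0]. *)
apply: card_sols_trace => //; move: hT0; rewrite in_setD1 => /andP[+ _].
by apply: contraNneq => tau0; rewrite -htau tau0 expr0n addr0.
Qed.
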